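(* Consider a stochastic submodular cover instance: finite ground set $U$, monotone submodular $f:2^U\to\mathbb{Z}_{\ge 0}$ with $Q:=f(U)$, mutually independent items $\mathbf{X}_1,\dots,\mathbf{X}_m$ with costs $c_i>0$, each realizing to a random element of $U$ with known distribution, such that the realizations of all items always cover $f$. For a parameter $\delta\in(0,1)$, the partial cover version asks to probe items until the realized set $R\subseteq U$ of probed items satisfies $f(R)>Q(1-\delta)$. There is a non-adaptive algorithm for this partial cover version whose expected cost is $O\!\left(\frac{\ln(1/\delta)}{\delta}\right)$ times the expected cost of an optimal adaptive solution for the (full) submodular cover problem (i.e. of covering $f$ to value $Q$).
   Context: Probing $\mathbf{X}_i$ costs $c_i$ and reveals its realization $X_i\in U$. A non-adaptive algorithm fixes an ordering of all items before observing any realization and then probes items in this order until the stopping condition (here $f(R)>Q(1-\delta)$) holds; its cost is the expected total cost of probed items. An adaptive solution for full cover chooses each next item based on all realizations observed so far and must reach $f(S)=Q$ with probability one; the optimal one has minimum expected cost.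
   Formalization: The bound is proved for all δ up to an absolute constant δ₀<1 (as δ→1, ln(1/δ)/δ tends to 0 and the claim fails; larger δ bounded away from 1 follow from the δ₀ ordering), and Q>0 is assumed, since for Q=0 the condition f(R)>Q(1-δ) cannot be met. *)

(* Defs.v *)
From HB Require Import structures.
From mathcomp Require Import all_boot all_order all_algebra all_fingroup.
From mathcomp Require Import all_classical all_reals all_analysis.
Set Implicit Arguments. Unset Strict Implicit. Unset Printing Implicit Defensive.
Import Order.TTheory GRing.Theory Num.Theory.
Local Open Scope ring_scope.

Notation realization U m := {ffun 'I_m -> U}.
(* An observation: for each item, Some u if probed and realized to u, else None. *)
Notation observation U m := {ffun 'I_m -> option U}.

Definition monotone_fn (U : finType) (f : {set U} -> nat) : Prop :=
  forall A B : {set U}, A \subset B -> (f A <= f B)%N.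

Definition submodular_fn (U : finType) (f : {set U} -> nat) : Prop :=
  forall A B : {set U}, (f (A :|: B) + f (A :&: B) <= f A + f B)%N.

(* Probability of a realization vector under mutually independent items:
   product of the marginals. *)
Definition real_prob (R : realType) (U : finType) (m : nat)
  (p : 'I_m -> U -> R) (x : realization U m) : R :=
  \prod_(i < m) p i (x i).

(* ---------- non-adaptive algorithm: an ordering sigma of all items ---------- *)
Definition prefix_set (U : finType) (m : nat) (sigma : 'S_m)
  (x : realization U m) (k : nat) : {set U} :=
  [set x (sigma j) | j : 'I_m & (j < k)%N].

Definition partial_done (R : realType) (U : finType) (f : {set U} -> nat)
  (delta : R) (S : {set U}) : bool :=
  (f [set: U])%:R * (1 - delta) < (f S)%:R.

Definition nonadaptive_cost (R : realType) (U : finType) (m : nat)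
  (f : {set U} -> nat) (c : 'I_m -> R) (delta : R) (sigma : 'S_m)
  (x : realization U m) : R :=
  \sum_(j < m | [forall k : 'I_m, (k <= j)%N ==>
                   ~~ partial_done f delta (prefix_set sigma x k)])
     c (sigma j).

Definition nonadaptive_exp_cost (R : realType) (U : finType) (m : nat)
  (f : {set U} -> nat) (c : 'I_m -> R) (p : 'I_m -> U -> R) (delta : R)
  (sigma : 'S_m) : R :=
  \sum_(x : realization U m) real_prob p x * nonadaptive_cost f c delta sigma x.

(* A (deterministic) adaptive policy maps the observations so far to the next
   item to probe, or None to stop.  Choosing an already probed item is
   treated as stopping. *)
Definition policy (U : finType) (m : nat) := observation U m -> option 'I_m.

Definition observe (U : finType) (m : nat) (obs : observation U m) (i : 'I_m)
  (u : U) : observation U m :=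
  [ffun j => if j == i then Some u else obs j].

(* Run the policy on realization x; returns final observation and cost.
   Each step probes a new item, so fuel m suffices. *)
Fixpoint adaptive_run (R : realType) (U : finType) (m : nat) (c : 'I_m -> R)
  (pol : policy U m) (x : realization U m) (n : nat) (obs : observation U m)
  : observation U m * R :=
  match n with
  | 0 => (obs, 0)
  | n'.+1 =>
      match pol obs with
      | Some i =>
          if obs i == None then
            let r := adaptive_run c pol x n' (observe obs i (x i)) in
            (r.1, c i + r.2)
          else (obs, 0)
      | None => (obs, 0)
      end
  end.

Definition empty_obs (U : finType) (m : nat) : observation U m := [ffun _ => None].

Definition observed_set (U : finType) (m : nat) (obs : observation U m) : {set U} :=
  [set u | [exists i, obs i == Some u]].

Definition adaptive_final (R : realType) (U : finType) (m : nat) (c : 'I_m -> R)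
  (pol : policy U m) (x : realization U m) : observation U m * R :=
  adaptive_run c pol x m (empty_obs U m).

Definition adaptive_feasible (R : realType) (U : finType) (m : nat)
  (f : {set U} -> nat) (c : 'I_m -> R) (p : 'I_m -> U -> R) (pol : policy U m)
  : Prop :=
  forall x : realization U m, 0 < real_prob p x ->
    f (observed_set (adaptive_final c pol x).1) = f [set: U].

Definition adaptive_exp_cost (R : realType) (U : finType) (m : nat)
  (c : 'I_m -> R) (p : 'I_m -> U -> R) (pol : policy U m) : R :=
  \sum_(x : realization U m) real_prob p x * (adaptive_final c pol x).2.

(* Main.v *)
(** The ordering is greedy: writing [S] for the realization of the items [L]
    probed so far and [Q] for the target value, the next item maximises its
    score per unit cost, where the score of [e] is the expectation, over the
    outcomes with [f S <= Q (1 - delta)], of the expected gain of [e] over [S]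
    divided by [Q - f S].

    Lower bound on the score.  Cut an adaptive policy off at budget [a], and let
    [B y] be what it realizes outside [L] on the realization [y].  For
    independent pending [x] and [y], the set [B y] need not help [S x], although
    [S x] and [B x] together cover [f] unless the policy overruns [a].  An
    exchange argument shows nevertheless that the average of the gain of [B y]
    over [S x], relative to [Q - f (S x)], is at least of order [delta].  The
    policy decides to probe [e] without seeing its value, so this average is at
    most a combination of scores with weights of total cost at most [a], whence
    some item has score per unit cost at least
    [delta / (4 a) * (P(pending) - 2 P(cost > a))].

    Upper bound on the scores.  Along each realization the relative gains
    telescope against [1 + ln ((Q - f S) / (delta Q))], hence their sum from any
    position on is at most [Lam = 1 + ln (1 / delta)] if that position is
    pending, and [0] otherwise.

    If [t j] is the cost of the first [j] items, summing [t j] times the [j]-th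
    score bounds it above by [Lam] times the cost [N] of the ordering; taking
    [a = t j / beta] with [beta = 8 Lam / delta] bounds it below by
    [2 Lam (N - 2 beta OPT)].  Hence [N <= 4 beta OPT]. *)

Require Import Defs.
From HB Require Import structures.
From mathcomp Require Import all_boot all_order all_algebra all_fingroup.
From mathcomp Require Import all_classical all_reals all_analysis.
From mathcomp Require Import ring lra.
Import Order.TTheory GRing.Theory Num.Theory.
Local Open Scope ring_scope.

Set Implicit Arguments.
Unset Strict Implicit.

(** * Submodular marginals and the exchange inequality *)

Section Marginals.
Variables (R : realType) (U : finType) (f : {set U} -> nat).
Implicit Types A B C : {set U}.
Hypothesis fmono : monotone_fn f.
Hypothesis fsub : submodular_fn f.

Definition fval (A : {set U}) : R := (f A)%:R.

Definition marginal (A B : {set U}) : R := fval (A :|: B) - fval A.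

Lemma fval_ge0 A : 0 <= fval A.
Proof. exact: ler0n. Qed.

Lemma fval_mono A B : A \subset B -> fval A <= fval B.
Proof. by move=> AB; rewrite ler_nat fmono. Qed.

Lemma fval_leT A : fval A <= fval [set: U].
Proof. by apply: fval_mono; apply: finset.subsetT. Qed.

Lemma marginal_ge0 A B : 0 <= marginal A B.
Proof. by rewrite subr_ge0 fval_mono// finset.subsetUl. Qed.

Lemma marginal_antitone (A B C : {set U}) :
  A \subset B -> marginal B C <= marginal A C.
Proof.
move=> AB; have := fsub B (A :|: C).
have -> : B :|: (A :|: C) = B :|: C.
  by rewrite finset.setUA (finset.setUidPl AB).
have : (f A <= f (B :&: (A :|: C)))%N.
  by apply: fmono; rewrite finset.subsetI AB finset.subsetUl.
rewrite -!(ler_nat R) !natrD /marginal /fval => h1 h2; lra.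
Qed.

Lemma marginal_imset (I : finType) (x : I -> U) (A : {set U}) (T : {set I}) :
  marginal A (x @: T) <= \sum_(i in T) marginal A [set x i].
Proof.
have -> : x @: T = \bigcup_(i in T) [set x i].
  apply/setP => u; apply/imsetP/bigcupP => [[i iT ->]|[i iT]].
    by exists i => //; rewrite inE.
  by rewrite inE => /eqP ->; exists i.
apply: (big_ind2 (fun B r => marginal A B <= r)) => //.
  by rewrite /marginal finset.setU0 subrr.
move=> B r C s hB hC.
have := @marginal_antitone A (A :|: B) C (finset.subsetUl _ _).
by move: hB hC; rewrite /marginal finset.setUA => *; lra.
Qed.

(* Take [A] maximising [v f(A) - 2 Q psi(A)], where [psi A] is the average
   relative gain of [A] over [S x].  Maximality against [A :|: B y] bounds the
   average marginal of [B y] over [A] by the right-hand side; comparison with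
   the empty set gives [psi A <= v / 2]; and as [S x :|: B x] is full for good
   [x], [psi A] is close to [v] as soon as that average marginal is small. *)
Lemma cross_marginal_ge (X : finType) (mu : X -> R) (S B : X -> {set U})
    (good : pred X) (delta : R) :
    0 < delta -> 0 < fval [set: U] ->
    (forall x, 0 <= mu x) ->
    (forall x, mu x != 0 ->
       delta * fval [set: U] <= fval [set: U] - fval (S x)) ->
    (forall x, mu x != 0 -> good x -> fval (S x :|: B x) = fval [set: U]) ->
  delta * ((\sum_x mu x) * (\sum_x mu x - 2 * \sum_(x | ~~ good x) mu x)) <=
  4 * \sum_x mu x *
    ((\sum_y mu y * marginal (S x) (B y)) / (fval [set: U] - fval (S x))).
Proof.
set Q := fval [set: U]; set rem := fun x => Q - fval (S x).
move=> delta_gt0 Q_gt0 mu_ge0 hrem hgood.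
set v := \sum_x mu x; set o := \sum_(x | _) mu x; set G := \sum_x _.
have v_ge0 : 0 <= v by exact: sumr_ge0.
have rem_gt0 x : mu x != 0 -> 0 < rem x.
  by move=> /hrem; apply: lt_le_trans; rewrite mulr_gt0.
pose psi A := \sum_x mu x * (marginal (S x) A / rem x).
pose Pi A := v * fval A - 2 * Q * psi A.
have [A Amax] : exists A, forall A', Pi A' <= Pi A.
  have [A _ h] := @Order.TotalTheory.arg_maxP _ _ _ finset.set0 xpredT Pi isT.
  by exists A => A'; exact: h.
pose g := \sum_y mu y * marginal A (B y).
have psi_le : psi A <= v / 2.
  have psi0 : psi finset.set0 = 0.
    by apply: big1 => x _; rewrite /marginal finset.setU0 subrr mul0r mulr0.
  have := Amax finset.set0; rewrite /Pi psi0 mulr0 subr0 => h.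
  have h1 : 0 <= v * fval finset.set0 by rewrite mulr_ge0// fval_ge0.
  have h2 : v * fval A <= v * Q by rewrite ler_wpM2l// fval_leT.
  have : Q * psi A <= Q * (v / 2) by lra.
  by rewrite ler_pM2l.
have g_le : v * g <= 2 * Q * G.
  have -> : G = \sum_y mu y * \sum_x mu x * (marginal (S x) (B y) / rem x).
    rewrite /G; under eq_bigr do rewrite mulr_suml mulr_sumr.
    rewrite exchange_big; apply: eq_bigr => y _; rewrite mulr_sumr.
    by apply: eq_bigr => x _; rewrite /rem; ring.
  rewrite mulr_sumr mulr_sumr; apply: ler_sum => y _.
  rewrite mulrCA [leRHS]mulrCA; apply: ler_wpM2l => //.
  have := Amax (A :|: B y); rewrite /Pi => h.
  have : psi (A :|: B y) - psi A <=
         \sum_x mu x * (marginal (S x) (B y) / rem x).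
    rewrite /psi -sumrB; apply: ler_sum => x _.
    have [->|mux] := eqVneq (mu x) 0; first by rewrite !mul0r subrr.
    rewrite -mulrBr -mulrBl ler_wpM2l//.
    rewrite ler_wpM2r ?invr_ge0 ?(ltW (rem_gt0 _ mux))//.
    have := @marginal_antitone (S x) (S x :|: A) (B y) (finset.subsetUl _ _).
    by rewrite /marginal finset.setUA; lra.
  move=> /(ler_wpM2l (ltW Q_gt0)) h'; rewrite [marginal A _]/marginal; lra.
have psi_ge : v - o - g / (delta * Q) <= psi A.
  rewrite /v /o /g mulr_suml [X in _ - X - _]big_mkcond/= -!sumrB.
  apply: ler_sum => x _.
  have [mux0|mux] := eqVneq (mu x) 0.
    by rewrite mux0 if_same !mul0r !subr0.
  have r0 := rem_gt0 _ mux.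
  have mA : 0 <= marginal (S x) A / rem x.
    by rewrite divr_ge0 ?marginal_ge0 ?ltW.
  have dQ : 0 < delta * Q by rewrite mulr_gt0.
  have mB : 0 <= marginal A (B x) / (delta * Q).
    by rewrite divr_ge0 ?marginal_ge0 ?ltW.
  case: ifPn => [_|]; rewrite ?negbK.
    rewrite subrr sub0r -mulrA -mulrN ler_wpM2l//.
    by apply: le_trans mA; rewrite oppr_le0.
  move=> gx; rewrite subr0 -mulrA -{1}[mu x]mulr1 -mulrBr ler_wpM2l//.
  rewrite lerBlDr.
  have h1 : rem x <= marginal (S x) A + marginal A (B x).
    have := @marginal_antitone A (S x :|: A) (B x) (finset.subsetUr _ _).
    have : Q <= fval (S x :|: A :|: B x).
      rewrite -(hgood _ mux gx); apply: fval_mono.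
      by rewrite finset.setSU// finset.subsetUl.
    by rewrite /marginal /rem; lra.
  (* The loss of a factor [delta] occurs here: [rem x] is at least [delta * Q] when [mu x != 0], and
     with this common denominator the average over [x] becomes [g]. *)
  have h2 : marginal A (B x) / rem x <= marginal A (B x) / (delta * Q).
    rewrite ler_wpM2l ?marginal_ge0// lef_pV2 ?posrE//; exact: hrem.
  apply: le_trans (lerD (lexx _) h2).
  by rewrite -mulrDl ler_pdivlMr// mul1r.
have dQ : 0 < delta * Q by rewrite mulr_gt0.
have h : delta * Q * (v / 2 - o) <= g.
  by rewrite mulrC -ler_pdivlMr//; lra.
have := ler_wpM2l v_ge0 h => h'.
rewrite -(ler_pM2l Q_gt0); lra.
Qed.

End Marginals.

(** * Independence: replacing one coordinate by a fresh draw *)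

Section Resampling.
Variables (R : realType) (U : finType) (m : nat) (p : 'I_m -> U -> R).

Lemma real_prob_ge0 (x : realization U m) :
  (forall i u, 0 <= p i u) -> 0 <= real_prob p x.
Proof. by move=> p_ge0; apply: prodr_ge0. Qed.

Definition eq_off (e : 'I_m) (x y : realization U m) :=
  forall i, i != e -> x i = y i.

Definition swap_coord (e : 'I_m) (z : realization U m * U) :
    realization U m * U :=
  ([ffun i => if i == e then z.2 else z.1 i], z.1 e).

Lemma swap_coordK e : involutive (swap_coord e).
Proof.
move=> [x u]; rewrite /swap_coord /= ffunE eqxx; congr pair.
by apply/ffunP => i; rewrite !ffunE; case: eqP => // ->.
Qed.

(** [F] reads nothing about item [e] from its first argument, so [x e] is independent of it. Attach
    a spare draw [u] to [x] and reindex by [swap_coord], which preserves the weight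
    [real_prob p x * p e u]. *)
Lemma resample (e : 'I_m) (F : realization U m -> U -> R) :
    \sum_u p e u = 1 ->
    (forall x y u, eq_off e x y -> F x u = F y u) ->
  \sum_x real_prob p x * F x (x e) =
  \sum_x real_prob p x * \sum_u p e u * F x u.
Proof.
move=> p1 FE.
transitivity (\sum_x \sum_u real_prob p x * p e u * F x (x e)).
  by apply: eq_bigr => x _; rewrite -mulr_suml -mulr_sumr p1 mulr1.
rewrite pair_big /= (reindex_inj (inv_inj (swap_coordK e))) /=.
under [RHS]eq_bigr do rewrite mulr_sumr.
rewrite pair_big /=; apply: eq_bigr => -[x u] _ /=.
rewrite ffunE eqxx mulrA (FE _ x); last first.
  by move=> i /negbTE ie; rewrite ffunE ie.
congr (_ * _); rewrite /real_prob (bigD1 e)//= [in RHS](bigD1 e)//= ffunE eqxx.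
rewrite (eq_bigr (fun i => p i (x i))); first by ring.
by move=> i /negbTE ie; rewrite ffunE ie.
Qed.

End Resampling.

(** * Adaptive policies cut off at a budget *)

Section Budget.
Variables (R : realType) (U : finType) (m : nat) (c : 'I_m -> R).
Variable pol : policy U m.
Implicit Types (x y : realization U m) (obs : observation U m).
Hypothesis c_gt0 : forall i, 0 < c i.

Lemma adaptive_run_ge0 x n obs : 0 <= (adaptive_run c pol x n obs).2.
Proof.
elim: n obs => //= n IH obs; case: (pol obs) => // i; case: ifP => //= _.
exact: addr_ge0 (ltW (c_gt0 i)) (IH _).
Qed.

(** The run stops before the first item that would exceed the budget; the test on item [i] is made
    before [x i] is read. *)
Fixpoint budget_items x (n : nat) obs (a : R) : {set 'I_m} :=
  if n is n'.+1 then
    if pol obs is Some i then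
      if (obs i == None) && (c i <= a) then
        i |: budget_items x n' (observe obs i (x i)) (a - c i)
      else finset.set0
    else finset.set0
  else finset.set0.

Lemma budget_items_cost x n obs a :
  0 <= a -> \sum_(i in budget_items x n obs a) c i <= a.
Proof.
elim: n obs a => [|n IH] obs a a_ge0 /=; first by rewrite finset.big_set0.
case: (pol obs) => [i|]; last by rewrite finset.big_set0.
case: ifP => [/andP[_ ca]|_]; last by rewrite finset.big_set0.
have := IH (observe obs i (x i)) (a - c i); rewrite subr_ge0 => /(_ ca).
set T := budget_items _ _ _ _ => hT.
have [iT|iT] := boolP (i \in T).
  by rewrite (finset.setUidPr _) ?finset.sub1set//; have := c_gt0 i; lra.
by rewrite big_setU1//=; lra.
Qed.

(** The runs on [x] and [y] coincide until [e] is chosen, and by then its membership is settled. *)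
Lemma budget_items_eq_off e x y n obs a :
  eq_off e x y ->
  (e \in budget_items x n obs a) = (e \in budget_items y n obs a).
Proof.
move=> xy; elim: n obs a => [|n IH] obs a //=.
case: (pol obs) => [i|] //; case: ifP => // _; rewrite !inE.
have [//|/= ei] := eqVneq e i.
by rewrite xy 1?eq_sym// IH.
Qed.

Lemma observed_set_observe obs i u :
  observed_set (observe obs i u) \subset u |: observed_set obs.
Proof.
apply/fintype.subsetP => w; rewrite !inE => /existsP[j].
rewrite ffunE; case: ifP => [_ /eqP[->]|_ h]; first by rewrite eqxx.
by apply/orP; right; apply/existsP; exists j.
Qed.

(** A run that costs at most [a] is never cut off, since every later cost is nonnegative. *)
Lemma observed_set_budget x n obs a :
  (adaptive_run c pol x n obs).2 <= a ->
  observed_set (adaptive_run c pol x n obs).1 \subset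
    observed_set obs :|: x @: budget_items x n obs a.
Proof.
elim: n obs a => [|n IH] obs a /=; first by rewrite finset.subsetUl.
case: (pol obs) => [i|]; last by rewrite finset.subsetUl.
case: ifP => /= [_|_]; last by rewrite finset.subsetUl.
set obs' := observe _ _ _ => ra.
have r0 := adaptive_run_ge0 x n obs'.
have -> : c i <= a by apply: le_trans ra; rewrite lerDl.
apply: (fintype.subset_trans (IH obs' (a - c i) _)); first by lra.
rewrite finset.imsetU1 finset.setUCA.
rewrite finset.setUA finset.setSU//; exact: observed_set_observe.
Qed.

Lemma observed_set_empty : observed_set (empty_obs U m) = finset.set0.
Proof.
apply/setP => u; rewrite !inE; apply/negbTE/existsP => -[i].
by rewrite ffunE.
Qed.

End Budget.

(** * Lower bound on the best score per unit cost *)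

Section GreedyRate.
Variables (R : realType) (U : finType) (m : nat) (f : {set U} -> nat).
Variables (c : 'I_m -> R) (p : 'I_m -> U -> R) (delta : R).
Implicit Types (x y : realization U m) (L : {set 'I_m}).
Hypothesis fmono : monotone_fn f.
Hypothesis fsub : submodular_fn f.
Hypothesis Q_gt0 : (0 < f [set: U])%N.
Hypothesis c_gt0 : forall i, 0 < c i.
Hypothesis p_ge0 : forall i u, 0 <= p i u.
Hypothesis p_sum1 : forall i, \sum_u p i u = 1.
Hypothesis delta_gt0 : 0 < delta.

Local Notation Q := (fval R f [set: U]).

Definition remaining (A : {set U}) : R := fval R f [set: U] - fval R f A.

Definition pending_weight L x : R :=
  real_prob p x * (~~ partial_done f delta (x @: L))%:R.

Definition pending_prob L : R := \sum_x pending_weight L x.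

Definition score L (e : 'I_m) : R :=
  \sum_x pending_weight L x *
    ((\sum_u p e u * marginal R f (x @: L) [set u]) / remaining (x @: L)).

Definition overrun_prob (pol : policy U m) (a : R) : R :=
  \sum_(x | ~~ ((adaptive_final c pol x).2 <= a)) real_prob p x.

Lemma pending_remaining A :
  ~~ partial_done f delta A = (delta * Q <= remaining A).
Proof.
rewrite /partial_done -leNgt /remaining /fval.
by apply/idP/idP => h; lra.
Qed.

Lemma pending_weight_ge0 L x : 0 <= pending_weight L x.
Proof. by rewrite mulr_ge0 ?real_prob_ge0. Qed.

Lemma pending_weight_le L x : pending_weight L x <= real_prob p x.
Proof.
rewrite /pending_weight; case: (~~ _); rewrite ?mulr1 ?mulr0//.
exact: real_prob_ge0.
Qed.

Lemma remaining_ge0 A : 0 <= remaining A.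
Proof. by rewrite subr_ge0 fval_leT. Qed.

Lemma score_ge0 L e : 0 <= score L e.
Proof.
apply: sumr_ge0 => x _; rewrite mulr_ge0 ?pending_weight_ge0//.
rewrite divr_ge0 ?remaining_ge0//; apply: sumr_ge0 => u _.
by rewrite mulr_ge0 ?marginal_ge0.
Qed.

Lemma imset_eq_off e L x y : e \notin L -> eq_off e x y -> x @: L = y @: L.
Proof.
move=> eL xy; apply: eq_in_imset => i iL; apply: xy.
by apply: contraNneq eL => <-.
Qed.

Lemma greedy_rate (pol : policy U m) L (K a : R) :
    adaptive_feasible f c p pol -> 0 <= a -> 0 <= K ->
    (forall e, e \notin L -> score L e <= K * c e) ->
  delta * (pending_prob L - 2 * overrun_prob pol a) <= 4 * (a * K).
Proof.
move=> feas a_ge0 K_ge0 scoreK.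
pose T y := budget_items c pol y m (empty_obs U m) a.
pose good x := (adaptive_final c pol x).2 <= a.
pose mu := pending_weight L.
have mu_ge0 x : 0 <= mu x := pending_weight_ge0 L x.
pose S x : {set U} := x @: L.
(* Dropping [L] keeps only items to which [scoreK] and resampling apply; the union with [S x] still
   covers. *)
pose B y : {set U} := y @: (T y :\: L).
have QR : 0 < Q by rewrite ltr0n.
have mu_rem x : mu x != 0 -> delta * Q <= remaining (S x).
  rewrite /mu /pending_weight -pending_remaining.
  by case: (partial_done _ _ _) => //; rewrite mulr0 eqxx.
have good_cover x : mu x != 0 -> good x -> fval R f (S x :|: B x) = Q.
  move=> mux gx; apply/eqP; rewrite eq_le fval_leT//=.
  have <- : fval R f (observed_set (adaptive_final c pol x).1) = Q.
    rewrite /fval feas// lt_neqAle real_prob_ge0// andbT eq_sym.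
    by apply: contraNneq mux; rewrite /mu /pending_weight => ->; rewrite mul0r.
  apply: fval_mono => //.
  apply: (fintype.subset_trans (observed_set_budget c_gt0 gx)).
  rewrite observed_set_empty finset.set0U -finset.imsetU; apply: finset.imsetS.
  apply/fintype.subsetP => i; rewrite !inE /T => ->; by case: (i \in L).
have := @cross_marginal_ge R U f fmono fsub _ mu S B good delta delta_gt0 QR
  mu_ge0 mu_rem good_cover.
set G := (X in _ <= 4 * X) => hG.
(* Weight with which the cut-off policy probes [e], under the measure [mu]. *)
pose w e := \sum_y mu y * (e \in T y :\: L)%:R.
have G_le : G <= \sum_e w e * score L e.
  have -> : \sum_e w e * score L e = \sum_x mu x * ((\sum_e w e *
      \sum_u p e u * marginal R f (S x) [set u]) / remaining (S x)).
    under eq_bigr do rewrite mulr_sumr.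
    rewrite exchange_big; apply: eq_bigr => x _.
    rewrite mulr_suml mulr_sumr; apply: eq_bigr => e _; rewrite /S /mu; ring.
  rewrite /G; apply: ler_sum => x _; apply: ler_wpM2l => //.
  apply: ler_wpM2r; first by rewrite invr_ge0 remaining_ge0.
  have -> : \sum_e w e * \sum_u p e u * marginal R f (S x) [set u] =
      \sum_y mu y * \sum_(e in T y :\: L) marginal R f (S x) [set y e].
    under [RHS]eq_bigr do rewrite big_mkcond mulr_sumr.
    rewrite [RHS]exchange_big; apply: eq_bigr => e _.
    have [eL|eL] := boolP (e \in L).
      rewrite /w big1 ?mul0r ?big1// => y _; first by rewrite inE eL mulr0.
      by rewrite inE eL mulr0.
    (* Neither the pending status of [L] nor the decision to probe [e] depends on [y e], hence
       [resample] applies and separates [w e] from the expected marginal. *)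
    pose H y u := (~~ partial_done f delta (y @: L))%:R * (e \in T y)%:R *
      marginal R f (S x) [set u].
    transitivity (\sum_y real_prob p y * H y (y e)).
      rewrite (resample (p_sum1 e)); last first.
        move=> y z u yz; rewrite /H (imset_eq_off eL yz) /T.
        by rewrite (budget_items_eq_off c pol m (empty_obs U m) a yz).
      rewrite /w mulr_suml; apply: eq_bigr => y _.
      rewrite inE eL /= /mu /pending_weight !mulr_sumr; apply: eq_bigr => u _.
      rewrite /H; ring.
    apply: eq_bigr => y _; rewrite inE eL /= /H /mu /pending_weight.
    by case: (e \in T y); rewrite ?mulr1 ?mulr0 ?mul0r ?mulr0// mulrA.
  apply: ler_sum => y _; rewrite ler_wpM2l//; exact: marginal_imset.
have w_ge0 e : 0 <= w e by apply: sumr_ge0 => y _; rewrite mulr_ge0.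
have wc_le : \sum_e w e * c e <= a * pending_prob L.
  rewrite /w; under eq_bigr do rewrite mulr_suml.
  rewrite exchange_big mulr_sumr; apply: ler_sum => y _ /=.
  under eq_bigr do rewrite -mulrA.
  rewrite -mulr_sumr mulrC ler_wpM2r//.
  apply: le_trans (budget_items_cost pol c_gt0 y m (empty_obs U m) a_ge0).
  rewrite [leRHS]big_mkcond; apply: ler_sum => e _.
  rewrite inE; case: (e \in L); case: (e \in _); rewrite ?mul1r ?mul0r//.
  exact: ltW.
have {}G_le : G <= K * (a * pending_prob L).
  apply: (le_trans G_le); apply: le_trans (ler_wpM2l K_ge0 wc_le).
  rewrite mulr_sumr; apply: ler_sum => e _.
  have [eL|eL] := boolP (e \in L).
    rewrite (_ : w e = 0) ?mul0r ?mulr0//.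
    by apply: big1 => y _; rewrite inE eL mulr0.
  by rewrite mulrCA; apply: ler_wpM2l => //; exact: scoreK.
have o_le : \sum_(x | ~~ good x) mu x <= overrun_prob pol a.
  by apply: ler_sum => x _; exact: pending_weight_le.
have v_ge0 : 0 <= pending_prob L by exact: sumr_ge0.
have aK : 0 <= a * K by rewrite mulr_ge0.
(* Both bounds on [G] carry a factor [pending_prob L], which is cancelled when positive. *)
have [v0|v0] := eqVneq (pending_prob L) 0.
  apply: (@le_trans _ _ 0); last lra.
  rewrite v0 sub0r (mulr_ge0_le0 (ltW delta_gt0))// oppr_le0 mulr_ge0//.
  by apply: sumr_ge0 => x _; exact: real_prob_ge0.
have v_gt0 : 0 < pending_prob L by rewrite lt_neqAle eq_sym v0.
rewrite -(ler_pM2l v_gt0).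
apply: (@le_trans _ _ (4 * G)); last by lra.
apply: le_trans hG.
rewrite mulrCA ler_pM2l// ler_pM2l// lerD2l lerN2.
by rewrite ler_pM2l.
Qed.

End GreedyRate.

(** * Greedy orderings and sums along prefixes *)

Section Orderings.
Variables (R : realType) (m : nat).

Definition prefix_items (sigma : 'S_m) (k : nat) : {set 'I_m} :=
  sigma @: [set j : 'I_m | (j < k)%N].

Lemma greedy_seq (r : {set 'I_m} -> 'I_m -> R) (n : nat) : (n <= m)%N ->
  exists s : seq 'I_m, [/\ size s = n, uniq s & forall e j, (j < n)%N ->
    e \notin take j s ->
    r [set i in take j s] e <= r [set i in take j s] (nth e s j)].
Proof.
elim: n => [_|n IH nm]; first by exists [::].
have [s [sz us hs]] := IH (ltnW nm).
have [e0 e0s] : exists e0, e0 \notin s.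
  apply/existsP; apply: contraLR nm; rewrite negb_exists -leqNgt => /forallP h.
  rewrite -sz -(card_uniqP us) -{1}(card_ord m); apply: subset_leq_card.
  by apply/fintype.subsetP => i _; have := h i; rewrite negbK.
have [e1 e1s hmax] := @Order.TotalTheory.arg_maxP _ _ _ e0
  (fun e => e \notin s) (r [set i in s]) e0s.
exists (rcons s e1); split; first by rewrite size_rcons sz.
  by rewrite rcons_uniq e1s.
move=> e j; rewrite ltnS leq_eqVlt => /orP[/eqP ->|jn].
  rewrite -cats1 -sz take_size_cat// nth_cat ltnn subnn /=; exact: hmax.
rewrite -cats1 takel_cat ?sz 1?ltnW// nth_cat sz jn; exact: hs.
Qed.

Lemma greedy_perm (r : {set 'I_m} -> 'I_m -> R) :
  exists sigma : 'S_m, forall (j e : 'I_m), e \notin prefix_items sigma j ->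
    r (prefix_items sigma j) e <= r (prefix_items sigma j) (sigma j).
Proof.
have [s [sz us hs]] := greedy_seq r (leqnn m).
pose t : m.-tuple 'I_m := Tuple (introT eqP sz).
have ti : injective (tnth t) by apply/tuple_uniqP.
exists (perm ti) => j e.
have -> : prefix_items (perm ti) j = [set i in take j s].
  apply/setP => i; rewrite inE; apply/imsetP/idP.
    move=> [k]; rewrite inE => kj ->; rewrite permE (tnth_nth i) /=.
    by rewrite -(nth_take i kj) mem_nth// size_take sz ltn_ord.
  move=> /(nthP i)[k]; rewrite size_take sz ltn_ord => kj <-.
  have km : (k < m)%N := ltn_trans kj (ltn_ord j).
  exists (Ordinal km); rewrite ?inE//.
  by rewrite permE (tnth_nth i) /= nth_take.
by rewrite inE permE (tnth_nth e) /=; exact: hs.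
Qed.

Lemma notin_prefix_items (sigma : 'S_m) (j : 'I_m) :
  sigma j \notin prefix_items sigma j.
Proof. by rewrite mem_imset ?inE ?ltnn//; exact: perm_inj. Qed.

Lemma prefix_itemsS (sigma : 'S_m) (j : 'I_m) :
  prefix_items sigma j.+1 = sigma j |: prefix_items sigma j.
Proof.
rewrite /prefix_items -finset.imsetU1.
suff -> : [set i : 'I_m | (i < j.+1)%N] = j |: [set i : 'I_m | (i < j)%N] by [].
by apply/setP => i; rewrite !inE ltnS leq_eqVlt.
Qed.

Lemma prefix_setE (U : finType) (sigma : 'S_m) (x : realization U m) k :
  prefix_set sigma x k = x @: prefix_items sigma k.
Proof.
rewrite /prefix_items -imset_comp; apply/setP => u.
apply/imsetP/imsetP => -[j]; rewrite ?inE => jk ->;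
  by exists j; rewrite ?inE.
Qed.

Lemma telescope_ord_le (h : 'I_m -> R) (phi : nat -> R) (i : nat) :
    (i <= m)%N -> (forall j : 'I_m, h j <= phi j - phi j.+1) ->
  \sum_(j < m | (i <= j)%N) h j <= phi i - phi m.
Proof.
move=> im hphi; apply: (le_trans (ler_sum _ (fun j _ => hphi j))).
rewrite -(big_geq_mkord _ _ xpredT (fun j => phi j - phi j.+1)).
rewrite -[leRHS]opprB -(telescope_sumr phi im) -sumrN.
by apply: ler_sum => j _; rewrite opprB.
Qed.

(** Every selected position is at most the last selected one, whose own prefix sum is below [X]. *)
Lemma sum_within_budget (d : 'I_m -> R) (X : R) : 0 <= X ->
    (forall j, 0 <= d j) ->
  \sum_(j < m | \sum_(i < m | (i <= j)%N) d i < X) d j <= X.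
Proof.
move=> X_ge0 d_ge0.
pose P (j : 'I_m) := \sum_(i < m | (i <= j)%N) d i < X.
case: (pickP P) => [j0 Pj0|P0]; last by rewrite (big_pred0 _ _ _ _ P0).
have [j Pj jmax] := arg_maxnP (fun j : 'I_m => j : nat) Pj0.
apply: le_trans (ltW Pj).
rewrite big_mkcond [leRHS]big_mkcond; apply: ler_sum => i _.
rewrite -/(P i); have [Pi|_] := boolP (P i).
  by rewrite (jmax i Pi : (i <= j)%N).
by case: ifP.
Qed.

End Orderings.

(** * The logarithmic potential *)

Section Potential.
Variables (R : realType) (U : finType) (f : {set U} -> nat) (delta : R).
Hypothesis fmono : monotone_fn f.
Hypothesis Q_gt0 : (0 < f [set: U])%N.
Hypothesis delta_gt0 : 0 < delta.
Implicit Types A B : {set U}.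

Local Notation Q := (fval R f [set: U]).
Local Notation rem := (remaining R f).

Definition potential A : R :=
  if partial_done f delta A then 0 else 1 + ln (rem A / (delta * Q)).

Let dQ_gt0 : 0 < delta * Q.
Proof. by rewrite mulr_gt0// ltr0n. Qed.

Lemma potential_ge0 A : 0 <= potential A.
Proof.
rewrite /potential; case: ifPn => //; rewrite pending_remaining => h.
by rewrite addr_ge0// ln_ge0// ler_pdivlMr// mul1r.
Qed.

Lemma potential_le A :
  potential A <= (~~ partial_done f delta A)%:R * (1 + ln delta^-1).
Proof.
rewrite /potential; case: ifPn => [_|]; first by rewrite mul0r.
rewrite pending_remaining mul1r lerD2l => h.
have Q0 : 0 < Q by rewrite ltr0n.
rewrite ler_ln ?posrE ?invr_gt0//; last first.
  by rewrite divr_gt0//; exact: lt_le_trans h.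
rewrite ler_pdivrMr// mulrA mulVf ?gt_eqF// mul1r.
by rewrite lerBlDr lerDl fval_ge0.
Qed.

(** While [A :|: B] is pending, [1 - r <= - ln r] for the ratio [r] of the remainders. When the
    target is crossed, the relative gain is at most [1], which the summand [1] of [potential] pays
    for. *)
Lemma potential_step A B :
  (~~ partial_done f delta A)%:R * (marginal R f A B / rem A) <=
    potential A - potential (A :|: B).
Proof.
have rAB : rem (A :|: B) <= rem A.
  by rewrite lerD2l lerN2 fval_mono// finset.subsetUl.
have mE : marginal R f A B = rem A - rem (A :|: B).
  by rewrite /marginal /remaining; ring.
have [dA|] := boolP (partial_done f delta A).
  rewrite /= mul0r /potential dA.
  have -> : partial_done f delta (A :|: B).
    apply/negPn; rewrite pending_remaining; apply/negP => h.
    have := le_trans h rAB; rewrite -pending_remaining; exact/negP/negPn.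
  by rewrite subrr.
move=> nA; have := nA; rewrite pending_remaining => hA.
have rA : 0 < rem A := lt_le_trans dQ_gt0 hA.
rewrite mul1r mE mulrBl divff ?gt_eqF// [potential A]/potential (negbTE nA).
have lnA : 0 <= ln (rem A / (delta * Q)).
  by rewrite ln_ge0// ler_pdivlMr// mul1r.
rewrite /potential; case: ifPn => [_|].
  rewrite subr0.
  have : 0 <= rem (A :|: B) / rem A.
    by rewrite divr_ge0 ?remaining_ge0.
  lra.
rewrite pending_remaining => hB.
have rB : 0 < rem (A :|: B) := lt_le_trans dQ_gt0 hB.
rewrite !ln_div ?posrE//.
have := @le_ln1Dx R (rem (A :|: B) / rem A - 1).
have q0 : 0 < rem (A :|: B) / rem A by rewrite divr_gt0.
rewrite [1 + (_ - 1)]addrC subrK ln_div ?posrE// => h.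
have : -1 < rem (A :|: B) / rem A - 1 by lra.
by move=> /h; lra.
Qed.

End Potential.

(** * Comparison of the greedy ordering with an adaptive policy *)

Section GreedyOrdering.
Variables (R : realType) (U : finType) (m : nat) (f : {set U} -> nat).
Variables (c : 'I_m -> R) (p : 'I_m -> U -> R) (delta : R) (sigma : 'S_m).
Hypothesis fmono : monotone_fn f.
Hypothesis fsub : submodular_fn f.
Hypothesis Q_gt0 : (0 < f [set: U])%N.
Hypothesis c_gt0 : forall i, 0 < c i.
Hypothesis p_ge0 : forall i u, 0 <= p i u.
Hypothesis p_sum1 : forall i, \sum_u p i u = 1.
Hypothesis delta_gt0 : 0 < delta.
Hypothesis delta_lt1 : delta < 1.

Let L (k : nat) := prefix_items sigma k.
Let v (j : 'I_m) := pending_prob f p delta (L j).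
Let t (j : 'I_m) := \sum_(i < m | (i <= j)%N) c (sigma i).
Let sc (j : 'I_m) := score f p delta (L j) (sigma j).
Let Lam := 1 + ln delta^-1.

Definition pending_cost : R :=
  \sum_(j < m) c (sigma j) * pending_prob f p delta (prefix_items sigma j).

Lemma nonadaptive_exp_cost_le :
  nonadaptive_exp_cost f c p delta sigma <= pending_cost.
Proof.
rewrite /pending_cost; under [leRHS]eq_bigr do rewrite mulr_sumr.
rewrite exchange_big; apply: ler_sum => x _ /=.
rewrite mulr_sumr big_mkcond; apply: ler_sum => j _.
case: ifPn => [/forallP/(_ j)|_]; last first.
  by rewrite mulr_ge0 ?pending_weight_ge0 ?(ltW (c_gt0 _)).
rewrite leqnn /= prefix_setE /pending_weight => ->.
by rewrite mulr1 mulrC.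
Qed.

(** Resampling in reverse: the fresh draw becomes the realized value, so that scores can be summed
    along a single realization. *)
Lemma score_realized (j : 'I_m) :
  sc j = \sum_x real_prob p x * ((~~ partial_done f delta (x @: L j))%:R *
    (marginal R f (x @: L j) [set x (sigma j)] / remaining R f (x @: L j))).
Proof.
rewrite (resample (p := p) (e := sigma j) (F := fun x u =>
  (~~ partial_done f delta (x @: L j))%:R *
    (marginal R f (x @: L j) [set u] / remaining R f (x @: L j))))//;
  last first.
  move=> x y u xy.
  by rewrite (imset_eq_off (notin_prefix_items sigma j) xy).
apply: eq_bigr => x _; rewrite /pending_weight -mulrA; congr (_ * _).
rewrite mulr_suml mulr_sumr; apply: eq_bigr => u _; ring.
Qed.

Lemma score_tail_le (i : 'I_m) : \sum_(j < m | (i <= j)%N) sc j <= Lam * v i.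
Proof.
under eq_bigr do rewrite score_realized.
rewrite exchange_big mulr_sumr; apply: ler_sum => x _ /=.
rewrite -mulr_sumr /pending_weight mulrCA ler_wpM2l ?real_prob_ge0//.
pose phi k := potential f delta (x @: L k).
apply: (@le_trans _ _ (phi i - phi m)).
  apply: telescope_ord_le => [|j]; first exact: ltnW.
  rewrite /phi /L prefix_itemsS finset.imsetU1 finset.setUC.
  exact: potential_step.
rewrite mulrC; apply: le_trans (potential_le Q_gt0 delta_gt0 _).
by rewrite lerBlDr lerDl potential_ge0.
Qed.

(** Expanding [t j] and exchanging sums leaves each [c (sigma i)] multiplied by the score tail from
    [i]. *)
Lemma weighted_score_le : \sum_j t j * sc j <= Lam * pending_cost.
Proof.
under eq_bigr do rewrite mulr_suml.
rewrite (exchange_big_dep xpredT)//= /pending_cost mulr_sumr.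
apply: ler_sum => i _; rewrite -mulr_sumr mulrCA ler_wpM2l ?(ltW (c_gt0 _))//.
exact: score_tail_le.
Qed.

(** On a realization of cost [X], the overrun positions satisfy [t j < beta * X], so their costs sum
    to at most [beta * X]. *)
Lemma overrun_sum_le (pol : policy U m) (beta : R) : 0 < beta ->
  \sum_j c (sigma j) * overrun_prob c p pol (t j / beta) <=
  beta * adaptive_exp_cost c p pol.
Proof.
move=> beta_gt0; under eq_bigr do rewrite mulr_sumr.
under eq_bigr do rewrite big_mkcond.
rewrite exchange_big mulr_sumr; apply: ler_sum => x _ /=.
rewrite -big_mkcond /= -mulr_suml mulrC mulrCA ler_wpM2l ?real_prob_ge0//.
set X := (adaptive_final c pol x).2.
have X_ge0 : 0 <= X by exact: adaptive_run_ge0.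
rewrite (eq_bigl (fun j : 'I_m => t j < beta * X)).
  apply: sum_within_budget => [|j]; last exact: ltW.
  by rewrite mulr_ge0// ltW.
by move=> j; rewrite -ltNge ltr_pdivrMr// [X * _]mulrC.
Qed.

Hypothesis greedy : forall (j e : 'I_m), e \notin prefix_items sigma j ->
  score f p delta (prefix_items sigma j) e / c e <=
  score f p delta (prefix_items sigma j) (sigma j) / c (sigma j).

Lemma greedy_cost_le (pol : policy U m) : adaptive_feasible f c p pol ->
  nonadaptive_exp_cost f c p delta sigma <=
  32 * ((1 + ln delta^-1) / delta * adaptive_exp_cost c p pol).
Proof.
move=> feas; apply: (le_trans nonadaptive_exp_cost_le).
have Lam_gt0 : 0 < Lam.
  by rewrite ltr_pwDl// ln_ge0// invf_ge1// ltW.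
(* Chosen so that [beta * delta / 4 = 2 * Lam], twice the factor in [weighted_score_le]; one
   [Lam * pending_cost] survives the comparison. *)
pose beta := 8 * Lam / delta.
have beta_gt0 : 0 < beta by rewrite divr_gt0// mulr_gt0.
have rate j : 2 * Lam * (c (sigma j) *
    (v j - 2 * overrun_prob c p pol (t j / beta))) <= t j * sc j.
  have cj := c_gt0 (sigma j).
  have t_ge0 : 0 <= t j by apply: sumr_ge0 => i _; exact: ltW.
  have K_ge0 : 0 <= sc j / c (sigma j) by rewrite divr_ge0 ?score_ge0 ?(ltW cj).
  have h := greedy_rate fmono fsub Q_gt0 c_gt0 p_ge0 p_sum1 delta_gt0 (L := L j)
    feas (divr_ge0 t_ge0 (ltW beta_gt0)) K_ge0.
  have {}h : delta * (v j - 2 * overrun_prob c p pol (t j / beta)) <=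
       4 * (t j / beta * (sc j / c (sigma j))).
    apply: h => e eL; rewrite -ler_pdivrMr//; exact: greedy.
  have k : 0 <= c (sigma j) * beta / 4.
    by rewrite divr_ge0// mulr_ge0 ?ltW.
  have := ler_wpM2l k h.
  set o := overrun_prob _ _ _ _.
  have -> : c (sigma j) * beta / 4 * (delta * (v j - 2 * o)) =
      2 * Lam * (c (sigma j) * (v j - 2 * o)).
    by rewrite /beta; field; rewrite gt_eqF.
  suff -> : c (sigma j) * beta / 4 * (4 * (t j / beta * (sc j / c (sigma j)))) =
      t j * sc j by [].
  by field; rewrite !gt_eqF.
have hsum : 2 * Lam * (pending_cost - 2 *
    \sum_j c (sigma j) * overrun_prob c p pol (t j / beta)) <=
    Lam * pending_cost.
  apply: le_trans weighted_score_le.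
  rewrite /pending_cost mulr_sumr -sumrB mulr_sumr; apply: ler_sum => j _.
  by have := rate j; rewrite /v /L; lra.
have ho := overrun_sum_le pol beta_gt0.
have {}hsum : 2 * (pending_cost - 2 *
    \sum_j c (sigma j) * overrun_prob c p pol (t j / beta)) <= pending_cost.
  by rewrite -(ler_pM2l Lam_gt0); lra.
have -> : 32 * (Lam / delta * adaptive_exp_cost c p pol) =
    4 * (beta * adaptive_exp_cost c p pol).
  by rewrite /beta; ring.
lra.
Qed.

End GreedyOrdering.

Theorem mainTheorem3 (R : realType) :
  exists (C delta0 : R), 0 < C /\ 0 < delta0 /\ delta0 < 1 /\
  forall (U : finType) (m : nat) (f : {set U} -> nat)
         (c : 'I_m -> R) (p : 'I_m -> U -> R),
    monotone_fn f -> submodular_fn f ->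
    (0 < f [set: U])%N ->
    (forall i, 0 < c i) ->
    (forall i u, 0 <= p i u) ->
    (forall i, \sum_(u : U) p i u = 1) ->
    (forall x : {ffun 'I_m -> U}, 0 < real_prob p x ->
        f [set x i | i : 'I_m] = f [set: U]) ->
    forall delta : R, 0 < delta -> delta <= delta0 ->
    exists sigma : 'S_m,
      forall pol : policy U m, adaptive_feasible f c p pol ->
        nonadaptive_exp_cost f c p delta sigma
          <= C * (ln (delta^-1) / delta) * adaptive_exp_cost c p pol.
Proof.
(* For [delta] up to [expR (-1)], [ln delta^-1] is at least [1], so [1 + ln delta^-1] is at most
   twice the logarithm and [32] doubles to [64]. *)
exists 64, (expR (-1)); split; first by []; split; first exact: expR_gt0.
split; first by rewrite expR_lt1 ltrN10.
move=> U m f c p fmono fsub Q_gt0 c_gt0 p_ge0 p_sum1 _ delta delta_gt0 delta_le.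
have [sigma greedy] := greedy_perm (fun L e => score f p delta L e / c e).
exists sigma => pol feas.
have delta_lt1 : delta < 1.
  by apply: le_lt_trans delta_le _; rewrite expR_lt1 ltrN10.
have ln_ge1 : 1 <= ln delta^-1.
  rewrite -[leLHS](@expRK R) ler_ln ?posrE ?expR_gt0 ?invr_gt0//.
  by rewrite -[leLHS]invrK lef_pV2 ?posrE ?invr_gt0 ?expR_gt0// -expRN.
have opt_ge0 : 0 <= adaptive_exp_cost c p pol.
  apply: sumr_ge0 => x _; rewrite mulr_ge0 ?real_prob_ge0//.
  exact: adaptive_run_ge0.
apply: (le_trans (greedy_cost_le fmono fsub Q_gt0 c_gt0 p_ge0 p_sum1 delta_gt0
  delta_lt1 greedy feas)).
rewrite mulrA; apply: ler_wpM2r => //.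
rewrite !mulrA; apply: ler_wpM2r; first by rewrite invr_ge0 ltW.
lra.
Qed.
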